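(* For every integer $n\geq 16$, $\mathrm{ex}_{\mathcal{P}}(n,S_{2,2})=2n-4$.
   Context: All graphs are finite and simple. For a graph $F$, the planar Turán number $\mathrm{ex}_{\mathcal{P}}(n,F)$ is the maximum number of edges in an $n$-vertex planar graph that contains no subgraph isomorphic to $F$. For positive integers $m,k$, the double star $S_{m,k}$ is the tree obtained from an edge $xy$ (the backbone) by joining $x$ to $m$ new vertices and $y$ to $k$ further new vertices, all these $m+k$ vertices distinct; thus $S_{m,k}$ has $m+k+2$ vertices. *)

(* Defs.v *)
From Stdlib Require Import Reals.
From mathcomp Require Import all_boot.

Set Implicit Arguments.
Unset Strict Implicit.
Unset Printing Implicit Defensive.

Definition simple_graph (T : finType) (E : {set {set T}}) : Prop :=
  forall e, e \in E -> #|e| = 2.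

Definition contains_subgraph (T U : finType) (E : {set {set T}})
  (EF : {set {set U}}) : Prop :=
  exists f : U -> T, injective f /\ forall e, e \in EF -> f @: e \in E.

(* Double star S_{m,k} on vertices 'I_(m+k+2):
   0 = x, 1 = y (backbone xy), 2..m+1 adjacent to x, m+2..m+k+1 adjacent to y. *)
Definition dstar_adj (m k : nat) (i j : 'I_(m + k + 2)) : bool :=
  [|| (nat_of_ord i == 0) && (nat_of_ord j == 1),
      (nat_of_ord i == 0) && (2 <= nat_of_ord j) && (nat_of_ord j < m + 2)
    | (nat_of_ord i == 1) && (m + 2 <= nat_of_ord j)].

Definition double_star (m k : nat) : {set {set 'I_(m + k + 2)}} :=
  [set e : {set 'I_(m + k + 2)} |
     [exists i, exists j, (e == [set i; j]) && dstar_adj i j]].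

Local Open Scope R_scope.

Definition in01 (t : R) : Prop := 0 <= t <= 1.
Definition in01o (t : R) : Prop := 0 < t < 1.

(* continuity of a curve gamma : [0,1] -> R^2 (product topology = Euclidean) *)
Definition curve_continuous (g : R -> R * R) : Prop :=
  forall t, in01 t -> forall eps, 0 < eps -> exists delta, 0 < delta /\
    forall s, in01 s -> Rabs (s - t) < delta ->
      Rabs (fst (g s) - fst (g t)) < eps /\ Rabs (snd (g s) - snd (g t)) < eps.

Definition simple_arc (g : R -> R * R) (p q : R * R) : Prop :=
  curve_continuous g /\
  (forall s t, in01 s -> in01 t -> g s = g t -> s = t) /\
  g 0 = p /\ g 1 = q.

Local Close Scope R_scope.

Definition planar (T : finType) (E : {set {set T}}) : Prop :=
  exists (pos : T -> R * R) (arc : T -> T -> R -> R * R),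
    injective pos /\
    (forall u v, [set u; v] \in E -> simple_arc (arc u v) (pos u) (pos v)) /\
    (forall u v w t, [set u; v] \in E -> in01o t -> arc u v t <> pos w) /\
    (forall u v u' v' s t, [set u; v] \in E -> [set u'; v'] \in E ->
       [set u; v] != [set u'; v'] -> in01o s -> in01o t ->
       arc u v s <> arc u' v' t).

Definition is_planar_turan_number (n : nat) (U : finType) (EF : {set {set U}})
  (m : nat) : Prop :=
  (exists E : {set {set 'I_n}}, simple_graph E /\ planar E /\
      ~ contains_subgraph E EF /\ #|E| = m) /\
  (forall E : {set {set 'I_n}}, simple_graph E -> planar E ->
      ~ contains_subgraph E EF -> #|E| <= m).

(* Main.v *)
Require Import Defs.
From Stdlib Require Import Reals ZArith Lra Lia.
From mathcomp Require Import all_boot zify.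

Set Implicit Arguments.
Unset Strict Implicit.
Unset Printing Implicit Defensive.

(* Lower bound: [K_{2,n-2}] has no two adjacent vertices of degree at least 3.

   Upper bound: call a vertex high if its degree is at least 3. In an
   [S_{2,2}]-free graph a high vertex with a high neighbour has degree at most 4,
   and if the degree is 4 its closed neighbourhood contains that of every high
   neighbour. A degree count with discharging from low to high vertices then
   gives the bound as soon as no [K_5] occurs; this is the only use of planarity.

   Nonplanarity of [K_5]: for disjoint edges [ab], [cd] the vector
   [g_ab s - g_cd t] does not vanish on the unit square, so its winding number,
   counted in quarter turns on a fine grid, is zero along the boundary. The sides
   of the square contribute the turning of [cd] seen from [a] and [b] and of [ab]
   seen from [c] and [d]. Adding these equations over the fifteen pairs of
   disjoint edges gives a contradiction modulo 8. *)

(** * Winding numbers on grids *)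

Section Walks.
Local Open Scope Z_scope.

(* Congruent to [b - a] modulo 4; the value 2, for opposite quadrants, carries no
   sign and is excluded wherever turns are added up geometrically. *)
Definition quarter_turn (a b : Z) : Z := (b - a + 1) mod 4 - 1.

Fixpoint walk (q : nat -> Z) (N : nat) : Z :=
  if N is N'.+1 then walk q N' + quarter_turn (q N') (q N'.+1) else 0.

(** Both sides agree modulo 4, and once the value 2 is excluded they differ by at most 3. *)
Lemma quarter_turn_triangle a b c :
  quarter_turn a b <> 2 -> quarter_turn b c <> 2 -> quarter_turn a c <> 2 ->
  quarter_turn a b + quarter_turn b c = quarter_turn a c.
Proof. rewrite /quarter_turn; Z.div_mod_to_equations; lia. Qed.

Lemma quarter_turn_shift a b a' b' k l :
  a' = a + 2 + 4 * k -> b' = b + 2 + 4 * l ->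
  quarter_turn a' b' = quarter_turn a b.
Proof. move=> -> ->; rewrite /quarter_turn; Z.div_mod_to_equations; lia. Qed.

(** Serves to pass from vectors to their opposites: a point seen from a moving curve turns exactly
    as the curve seen from the point. *)
Lemma walk_shift (q q' : nat -> Z) N :
  (forall i, exists k, q' i = q i + 2 + 4 * k) -> walk q' N = walk q N.
Proof.
move=> sh; elim: N => //= N ->.
have [[k Hk] [l Hl]] := (sh N, sh N.+1).
by rewrite (quarter_turn_shift Hk Hl).
Qed.

Lemma walk_mod4 q N : exists k, walk q N = q N - q 0%N + 4 * k.
Proof.
elim: N => [|N [k IH]]; first by exists 0; rewrite /=; lia.
exists (k - (q N.+1 - q N + 1) / 4); rewrite [LHS]/= IH /quarter_turn.
have := Z.div_mod (q N.+1 - q N + 1) 4; lia.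
Qed.

(** A discrete Stokes argument: a diagonal cuts each cell into two triangles, around which the
    turning vanishes; cells add up to strips and strips to the rectangle. *)
Lemma walk_grid (r : nat -> nat -> Z) M N :
  (forall i i' j j', (i' = i \/ i' = i.+1) -> (j' = j \/ j' = j.+1) ->
     quarter_turn (r i j) (r i' j') <> 2) ->
  walk (fun i => r i 0%N) N + walk (r N) M =
  walk (r 0%N) M + walk (fun i => r i M) N.
Proof.
move=> ok.
have strip i : walk (r i) M + quarter_turn (r i M) (r i.+1 M) =
               quarter_turn (r i 0%N) (r i.+1 0%N) + walk (r i.+1) M.
  elim: M => [|M IH] /=; first lia.
  have oD : quarter_turn (r i M) (r i.+1 M.+1) <> 2 by apply: ok; right.
  have oL : quarter_turn (r i M) (r i.+1 M) <> 2 by apply: ok; [right|left].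
  have oR : quarter_turn (r i M.+1) (r i.+1 M.+1) <> 2 by apply: ok; [right|left].
  have oB : quarter_turn (r i M) (r i M.+1) <> 2 by apply: ok; [left|right].
  have oT : quarter_turn (r i.+1 M) (r i.+1 M.+1) <> 2 by apply: ok; [left|right].
  have := quarter_turn_triangle oL oT oD.
  have := quarter_turn_triangle oB oR oD.
  lia.
elim: N => [|N IH] /=; first lia.
have := strip N; lia.
Qed.

(* An equation for [a < b] and [c < d], read modulo 8, has constant term 4 exactly
   when the two pairs interleave, which happens five times; every winding number
   occurs in exactly two of the fifteen equations. *)
Lemma no_K5_windings (W : 'I_5 -> 'I_5 -> 'I_5 -> Z) (D : 'I_5 -> 'I_5 -> Z) :
  (forall i j, i != j -> exists k, D i j = D j i + 2 + 4 * k) ->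
  (forall u a b, a != b -> exists k, W u a b = D u b - D u a + 4 * k) ->
  (forall a b c d, uniq [:: a; b; c; d] ->
     W c a b + W b c d = W a c d + W d a b) ->
  False.
Proof.
move=> sym cong cell.
(* Integer witnesses of the congruences, chosen as functions so that the fifteen instances share
   their unknowns when [lia] combines them. *)
pose m i j := (D i j - D j i - 2) / 4.
pose k u a b := (W u a b - (D u b - D u a)) / 4.
have mP i j : i != j -> D i j = D j i + 2 + 4 * m i j.
  by move=> /sym[l El]; rewrite /m; Z.div_mod_to_equations; lia.
have {}cell a b c d : uniq [:: a; b; c; d] ->
    D c b - D c a + 4 * k c a b + (D b d - D b c + 4 * k b c d) =
    D a d - D a c + 4 * k a c d + (D d b - D d a + 4 * k d a b).
  have kP u i j : i != j -> W u i j = D u j - D u i + 4 * k u i j.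
    by move=> /(cong u)[l El]; rewrite /k; Z.div_mod_to_equations; lia.
  move=> u; move: (u) => /cell; move: u.
  rewrite /= !inE !negb_or !andbT => /and3P[/and3P[ab _ _] _ cd].
  by rewrite !kP.
clearbody m k.
pose o0 : 'I_5 := Ordinal (isT : (0 < 5)%N).
pose o1 : 'I_5 := Ordinal (isT : (1 < 5)%N).
pose o2 : 'I_5 := Ordinal (isT : (2 < 5)%N).
pose o3 : 'I_5 := Ordinal (isT : (3 < 5)%N).
pose o4 : 'I_5 := Ordinal (isT : (4 < 5)%N).
have := mP o1 o0 isT; have := mP o2 o0 isT.
have := mP o3 o0 isT; have := mP o4 o0 isT.
have := mP o2 o1 isT; have := mP o3 o1 isT.
have := mP o4 o1 isT; have := mP o3 o2 isT.
have := mP o4 o2 isT; have := mP o4 o3 isT.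
have := cell o0 o1 o2 o3 isT; have := cell o0 o1 o2 o4 isT.
have := cell o0 o1 o3 o4 isT; have := cell o0 o2 o1 o3 isT.
have := cell o0 o2 o1 o4 isT; have := cell o0 o2 o3 o4 isT.
have := cell o0 o3 o1 o2 isT; have := cell o0 o3 o1 o4 isT.
have := cell o0 o3 o2 o4 isT; have := cell o0 o4 o1 o2 isT.
have := cell o0 o4 o1 o3 isT; have := cell o0 o4 o2 o3 isT.
have := cell o1 o2 o3 o4 isT; have := cell o1 o3 o2 o4 isT.
have := cell o1 o4 o2 o3 isT.
clear; clearbody o0 o1 o2 o3 o4; lia.
Qed.

End Walks.

(** * Quadrants of plane vectors *)

Section Quadrants.
Local Open Scope R_scope.

(* Half-open quadrants, so that [z] and [- z] always lie in opposite ones. *)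
Definition quadrant (z : R * R) : Z :=
  if Rlt_dec 0 z.1 then (if Rle_dec 0 z.2 then 0 else 3)%Z
  else if Rlt_dec 0 z.2 then 1%Z
  else if Rlt_dec z.1 0 then 2%Z else 3%Z.

Definition vsub (z w : R * R) : R * R := (z.1 - w.1, z.2 - w.2).

Lemma vsub_eq0 z w : vsub z w = (0, 0) -> z = w.
Proof. by case: z w => [a b] [c d] [/= ? ?]; congr pair; lra. Qed.

Lemma quadrant_opp z w : z <> w ->
  exists k, quadrant (vsub w z) = (quadrant (vsub z w) + 2 + 4 * k)%Z.
Proof.
case: z w => [a b] [c d] neq; rewrite /quadrant /vsub /=.
have {}neq : a < c \/ c < a \/ b < d \/ d < b.
  have [|[ac|]] := Rtotal_order a c; have [|[bd|]] := Rtotal_order b d; try tauto.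
  by case: neq; rewrite ac bd.
do ?[case: Rlt_dec => ? | case: Rle_dec => ?]; try (exfalso; lra).
all: by [exists 0%Z | exists (-1)%Z].
Qed.

(** Some coordinate of [z0] is nonzero and keeps its sign nearby; an open half-plane bounded by an
    axis meets only two quadrants, and these are consecutive. *)
Lemma quarter_turn_near z0 : z0 <> (0, 0) -> exists eta, 0 < eta /\
  forall z z', Rabs (z.1 - z0.1) < eta -> Rabs (z.2 - z0.2) < eta ->
    Rabs (z'.1 - z0.1) < eta -> Rabs (z'.2 - z0.2) < eta ->
    quarter_turn (quadrant z) (quadrant z') <> 2%Z.
Proof.
case: z0 => [a b] nz.
have [eta [eta0 Heta]] : exists eta, 0 < eta /\
    (eta <= a \/ eta <= - a \/ a = 0 /\ (eta <= b \/ eta <= - b)).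
  case: (Rtotal_order a 0) => [?|[a0|?]]; first by exists (- a); lra.
  - case: (Rtotal_order b 0) => [?|[b0|?]]; first by exists (- b); lra.
    + by case: nz; rewrite a0 b0.
    + by exists b; lra.
  - by exists a; lra.
exists eta; split=> // -[x y] [x' y'] /=.
move=> /Rabs_def2[? ?] /Rabs_def2[? ?] /Rabs_def2[? ?] /Rabs_def2[? ?].
rewrite /quadrant /=.
by do ?[case: Rlt_dec => ? | case: Rle_dec => ?] => //; exfalso; lra.
Qed.

End Quadrants.

(** * Compactness of the unit interval *)

Section Compactness.
Local Open Scope R_scope.

(** Supremum argument: [X] collects the points up to which a single [e] works. The local radius at
    its supremum [m] would carry [X] beyond [m], unless 1 is reached first. *)
Lemma locally_uniform_in01 (Q : R -> R -> Prop) :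
  (forall s e e', e' <= e -> Q s e -> Q s e') ->
  (forall s, in01 s -> exists e, 0 < e /\
     forall s', in01 s' -> Rabs (s' - s) < e -> Q s' e) ->
  exists e, 0 < e /\ forall s, in01 s -> Q s e.
Proof.
move=> mono loc.
pose X x := in01 x /\ exists e, 0 < e /\ forall s, in01 s -> s <= x -> Q s e.
have X0 : X 0.
  split; first by rewrite /in01; lra.
  have [|e [e0 He]] := loc 0; first by rewrite /in01; lra.
  exists e; split=> // s s01 s0; apply: He => //.
  by move: s01; rewrite /in01 => ?; apply: Rabs_def1; lra.
have [||m [ub lub]] := completeness X; first by exists 1 => x [[]].
  by exists 0.
have m01 : in01 m.
  by split; [exact: ub | apply: lub => x [[]]].
have [e [e0 He]] := loc m m01.
have [x [[x01 [e1 [e1_0 He1]]] mx]] : exists x, X x /\ m - e < x.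
  apply: Classical_Prop.NNPP => no; have : m <= m - e; last lra.
  apply: lub => x Xx; apply: Rnot_lt_le => ?; apply: no; by exists x.
pose y := Rmin 1 (m + e / 2).
have yE : y = 1 \/ y = m + e / 2.
  by rewrite /y /Rmin; case: Rle_dec; auto.
have y1 : y <= 1 by apply: Rmin_l.
have yme : y <= m + e / 2 by apply: Rmin_r.
have xm : x <= m by apply: ub; split => //; exists e1.
have Qy s : in01 s -> s <= y -> Q s (Rmin e e1).
  move=> s01 sy; have [sx|xs] := Rle_lt_dec s x.
    by apply: (mono _ e1); [exact: Rmin_r | exact: He1].
  apply: (mono _ e); [exact: Rmin_l | apply: He => //].
  by apply: Rabs_def1; lra.
have ee1 : 0 < Rmin e e1 by apply: Rmin_pos.
exists (Rmin e e1); split => // s s01; apply: (Qy) => //.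
case: yE => [->|yE]; first by case: s01.
have : y <= m; last lra.
apply: ub; split; first by move: m01; rewrite /in01; lra.
by exists (Rmin e e1).
Qed.

Lemma exists_common_eps (I : finType) (P : I -> R -> Prop) :
  (forall i e e', e' <= e -> P i e -> P i e') ->
  (forall i, exists e, 0 < e /\ P i e) ->
  exists e, 0 < e /\ forall i, P i e.
Proof.
move=> mono ex.
suff [e [e0 He]] : exists e, 0 < e /\ forall i, i \in enum I -> P i e.
  by exists e; split=> // i; apply: He; rewrite mem_enum.
elim: (enum I) => [|i s [e [e0 IH]]]; first by exists 1; split; [lra|].
have [e' [e'0 He']] := ex i.
exists (Rmin e e'); split; first exact: Rmin_pos.
move=> j; rewrite inE => /predU1P[->|js].
  by apply: mono He'; apply: Rmin_r.
by apply: mono (IH _ js); apply: Rmin_l.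
Qed.

(** A Lebesgue number for the unit square: compactness is applied in [t] for fixed [s0], then in
    [s]. *)
Lemma quarter_turn_uniform (g h : R -> R * R) :
  curve_continuous g -> curve_continuous h ->
  (forall s t, in01 s -> in01 t -> g s <> h t) ->
  exists e, 0 < e /\ forall s s' t t', in01 s -> in01 s' -> in01 t -> in01 t' ->
    Rabs (s' - s) < e -> Rabs (t' - t) < e ->
    quarter_turn (quadrant (vsub (g s) (h t))) (quadrant (vsub (g s') (h t')))
      <> 2%Z.
Proof.
move=> cg ch gh.
pose ok s s' t t' :=
  quarter_turn (quadrant (vsub (g s) (h t))) (quadrant (vsub (g s') (h t')))
    <> 2%Z.
have near0 s0 t0 : in01 s0 -> in01 t0 -> exists e, 0 < e /\
    forall s s' t t', in01 s -> in01 s' -> in01 t -> in01 t' ->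
    Rabs (s - s0) < e -> Rabs (s' - s0) < e ->
    Rabs (t - t0) < e -> Rabs (t' - t0) < e -> ok s s' t t'.
  move=> s01 t01.
  have [|eta [eta0 Heta]] := @quarter_turn_near (vsub (g s0) (h t0)).
    by move/vsub_eq0; apply: gh.
  have [|d1 [d10 H1]] := cg s0 s01 (eta / 2); first lra.
  have [|d2 [d20 H2]] := ch t0 t01 (eta / 2); first lra.
  have [m1 m2] := (Rmin_l d1 d2, Rmin_r d1 d2).
  exists (Rmin d1 d2); split; first exact: Rmin_pos.
  move=> s s' t t' is1 is1' it it' ss ss' tt tt'.
  have [/Rabs_def2 ? /Rabs_def2 ?] := H1 s is1 (Rlt_le_trans _ _ _ ss m1).
  have [/Rabs_def2 ? /Rabs_def2 ?] := H1 s' is1' (Rlt_le_trans _ _ _ ss' m1).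
  have [/Rabs_def2 ? /Rabs_def2 ?] := H2 t it (Rlt_le_trans _ _ _ tt m2).
  have [/Rabs_def2 ? /Rabs_def2 ?] := H2 t' it' (Rlt_le_trans _ _ _ tt' m2).
  by apply: Heta; rewrite /vsub /=; apply: Rabs_def1; lra.
have near_s s0 : in01 s0 -> exists e, 0 < e /\
    forall t, in01 t -> forall s s' t', in01 s -> in01 s' -> in01 t' ->
    Rabs (s - s0) < e -> Rabs (s' - s0) < e -> Rabs (t' - t) < e -> ok s s' t t'.
  move=> is0; apply: locally_uniform_in01.
    by move=> t e e' ? H *; apply: H => //; lra.
  move=> t0 it0; have [e [e0 He]] := near0 s0 t0 is0 it0.
  (* Halving puts both [t] and [t'] within [e] of [t0]. *)
  exists (e / 2); split; first lra.
  move=> t it /Rabs_def2 ? s s' t' ? ? ? ? ? /Rabs_def2 ?.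
  by apply: He => //; (lra || (apply: Rabs_def1; lra)).
suff [e [e0 He]] : exists e, 0 < e /\
    forall s, in01 s -> forall s' t t', in01 s' -> in01 t -> in01 t' ->
    Rabs (s' - s) < e -> Rabs (t' - t) < e -> ok s s' t t'.
  by exists e; split=> // *; apply: He.
apply: locally_uniform_in01.
  by move=> s e e' ? H *; apply: H => //; lra.
move=> s0 is0; have [e [e0 He]] := near_s s0 is0.
exists (e / 2); split; first lra.
move=> s is1 /Rabs_def2 ? s' t t' ? ? ? /Rabs_def2 ? ?.
by apply: He => //; (lra || (apply: Rabs_def1; lra)).
Qed.

End Compactness.

(** * Nonplanarity of K_5 *)

Section K5.
Local Open Scope R_scope.

(** Capped at 1 because [walk_grid] and [walk_shift] quantify over all indices, also those beyond
    [N]. *)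
Definition node (N i : nat) : R := Rmin 1 (INR i / INR N).

Lemma node_in01 N i : 0 < INR N -> in01 (node N i).
Proof.
move=> N0; split; last exact: Rmin_l.
by apply: Rmin_glb; [lra | apply: Rle_mult_inv_pos => //; apply: pos_INR].
Qed.

Lemma node0 N : node N 0 = 0.
Proof. by rewrite /node /= /Rdiv Rmult_0_l Rmin_right; lra. Qed.

Lemma nodeN N : 0 < INR N -> node N N = 1.
Proof. by move=> N0; rewrite /node Rdiv_diag ?Rmin_left; lra. Qed.

Lemma node_near N i i' e : 0 < INR N -> 0 < e -> / INR N < e ->
  i' = i \/ i' = i.+1 -> Rabs (node N i' - node N i) < e.
Proof.
move=> N0 e0 Ne [->|->]; first by rewrite Rminus_diag Rabs_R0.
rewrite /node S_INR Rdiv_plus_distr /Rdiv Rmult_1_l.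
have ? := Rinv_0_lt_compat _ N0.
by rewrite /Rmin; do 2!case: Rle_dec => ?; apply: Rabs_def1; lra.
Qed.

Definition winding (g : R -> R * R) (p : R * R) (N : nat) : Z :=
  walk (fun i => quadrant (vsub (g (node N i)) p)) N.

Lemma winding_mod4 g a b p N : 0 < INR N -> g 0 = a -> g 1 = b ->
  exists k, (winding g p N =
    quadrant (vsub b p) - quadrant (vsub a p) + 4 * k)%Z.
Proof.
move=> N0 ga gb; have := walk_mod4 (fun i => quadrant (vsub (g (node N i)) p)) N.
by rewrite node0 nodeN // ga gb.
Qed.

(** This is [walk_grid] for the vector [g s - h t]. On the sides [s = 0] and [s = 1] it is the
    opposite of [h] seen from [a] and from [b], which [walk_shift] absorbs. *)
Lemma winding_cell (g h : R -> R * R) a b c d :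
  simple_arc g a b -> simple_arc h c d ->
  (forall s t, in01 s -> in01 t -> g s <> h t) ->
  exists e, 0 < e /\ forall N, 0 < INR N -> / INR N < e ->
    (winding g c N + winding h b N = winding h a N + winding g d N)%Z.
Proof.
move=> [cg [_ [<- <-]]] [ch [_ [<- <-]]] gh.
have [e [e0 He]] := quarter_turn_uniform cg ch gh.
exists e; split=> // N N0 Ne.
have i0 : in01 0 by rewrite /in01; lra.
have i1 : in01 1 by rewrite /in01; lra.
pose r i j := quadrant (vsub (g (node N i)) (h (node N j))).
have hE s : in01 s -> winding h (g s) N =
    walk (fun j => quadrant (vsub (g s) (h (node N j)))) N.
  move=> s01; apply: walk_shift => j; apply: quadrant_opp; apply: gh => //.
  exact: node_in01.
have := @walk_grid r N N; rewrite /r nodeN // node0 -!hE //; apply.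
by move=> i i' j j' Hi Hj; apply: He; solve [exact: node_in01 | exact: node_near].
Qed.

Lemma planar_no_K5 (T : finType) (E : {set {set T}}) (x : 'I_5 -> T) :
  planar E -> injective x ->
  ~ (forall i j, i != j -> [set x i; x j] \in E).
Proof.
move=> [pos [arc [pos_inj [arcP [arc_pos arc_arc]]]]] x_inj xE.
pose g i j := arc (x i) (x j); pose p i := pos (x i).
have gP i j : i != j -> simple_arc (g i j) (p i) (p j) by move=> /xE/arcP.
have pn i j : i != j -> p i <> p j by move=> /eqP ij /pos_inj/x_inj.
have ends i j s : i != j -> in01 s -> [\/ in01o s, g i j s = p i | g i j s = p j].
  move=> /gP[_ [_ [g0 g1]]] [s0 s1].
  have [s_0|s_0] := Req_dec s 0; first by rewrite s_0; constructor 2.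
  have [s_1|s_1] := Req_dec s 1; first by rewrite s_1; constructor 3.
  by constructor 1; rewrite /in01o; lra.
(* The closed arcs must be disjoint, so endpoints are treated too: [arc_pos] separates an open arc
   from a vertex, injectivity of [pos] separates two vertices. *)
have disj a b c d : uniq [:: a; b; c; d] ->
    forall s t, in01 s -> in01 t -> g a b s <> g c d t.
  rewrite /= !inE !negb_or !andbT => /and3P[/and3P[ab ac ad] /andP[bc bd] cd].
  move=> s t /(ends _ _ _ ab) s01 /(ends _ _ _ cd) t01.
  have abcd : [set x a; x b] != [set x c; x d].
    apply/eqP => /setP/(_ (x a)).
    by rewrite !inE eqxx !(inj_eq x_inj) (negbTE ac) (negbTE ad).
  case: s01 t01 => [s01|->|->] [t01|->|->]; try exact: pn.
  - exact: arc_arc (xE _ _ ab) (xE _ _ cd) abcd s01 t01.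
  - exact: arc_pos (xE _ _ ab) s01.
  - exact: arc_pos (xE _ _ ab) s01.
  - by move=> /esym; apply: arc_pos (xE _ _ cd) t01.
  - by move=> /esym; apply: arc_pos (xE _ _ cd) t01.
(* With the guard [uniq] inside, degenerate quadruples accept any [e], and one grid serves the whole
   finite type of quadruples. *)
pose cell (q : 'I_5 * 'I_5 * 'I_5 * 'I_5) e :=
  let: (a, b, c, d) := q in uniq [:: a; b; c; d] ->
  forall N, 0 < INR N -> / INR N < e ->
  (winding (g a b) (p c) N + winding (g c d) (p b) N =
   winding (g c d) (p a) N + winding (g a b) (p d) N)%Z.
have [|[[[a b] c] d]|e [e0 He]] := @exists_common_eps _ cell.
- by move=> [[[a b] c] d] e e' ? H u N ? ?; apply: H => //; lra.
- rewrite /cell; have [u|_] := boolP (uniq _); last by exists 1; split=> //; lra.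
  have := disj _ _ _ _ u; move: u.
  rewrite /= !inE !negb_or !andbT => /and3P[/and3P[ab _ _] _ cd].
  by move=> /(winding_cell (gP _ _ ab) (gP _ _ cd))[e [e0 He]]; exists e.
have [N [Ne /lt_0_INR N0]] := archimed_cor1 e e0.
apply: (@no_K5_windings (fun u a b => winding (g a b) (p u) N)
          (fun u v => quadrant (vsub (p v) (p u)))).
- by move=> i j ij; apply/quadrant_opp/pn.
- by move=> u a b /gP[_ [_ [ga gb]]]; apply: winding_mod4.
- by move=> a b c d u; apply: (He (a, b, c, d)).
Qed.

End K5.

(** * Discharging *)

Section Discharging.
Variable T : finType.

(** Here [t v u] is the charge sent from [v] to [u]; its total over all pairs enters both sides and
    cancels. *)
Lemma discharging (a b : T -> nat) (t : T -> T -> nat) :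
  (forall v, a v + \sum_u t v u <= b v + \sum_u t u v) ->
  \sum_v a v <= \sum_v b v.
Proof.
move=> h; have := @leq_sum _ (index_enum T) predT _ _ (fun v _ => h v).
by rewrite !big_split /= (exchange_big_dep predT) //= leq_add2r.
Qed.

Variable e : rel T.
Hypotheses (e_sym : symmetric e) (e_irr : irreflexive e).

Definition nbrs v : {set T} := [set u | e v u].
Notation deg v := #|nbrs v|.

Definition count_nbrs v (P : pred T) := #|[set u in nbrs v | P u]|.

Lemma sum_nbrs_out v (P : pred T) : \sum_u (e v u && P u) = count_nbrs v P.
Proof.
rewrite /count_nbrs -sum1dep_card [RHS]big_mkcond; apply: eq_bigr => u _.
by rewrite inE; case: (e v u); case: (P u).
Qed.

Lemma sum_nbrs_in v (P : pred T) : \sum_u (e u v && P u) = count_nbrs v P.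
Proof. by rewrite -sum_nbrs_out; apply: eq_bigr => u _; rewrite e_sym. Qed.

Lemma count_nbrs_le v P : count_nbrs v P <= deg v.
Proof. by apply/subset_leq_card/subsetP => u; rewrite inE => /andP[]. Qed.

Lemma count_nbrs0 v P : (forall u, P u = false) -> count_nbrs v P = 0.
Proof. by move=> P0; apply: eq_card0 => u; rewrite !inE P0 andbF. Qed.

Lemma count_nbrs_all v (P : pred T) : (forall u, e v u -> P u) -> count_nbrs v P = deg v.
Proof. by move=> PT; apply: eq_card => u; rewrite !inE; apply: andb_idr => /PT. Qed.

Hypothesis noS22 : forall x y a b c d, uniq [:: x; y; a; b; c; d] ->
  e x y -> e x a -> e x b -> e y c -> e y d -> False.

(** Two such neighbours would be the leaves at [x] of an [S_{2,2}] with backbone [xy] and leaves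
    [c], [d] at [y]. *)
Lemma card_nbrs_outside x y c d : e x y -> e y c -> e y d ->
  c != x -> d != x -> c != d -> #|nbrs x :\: [set y; c; d]| <= 1.
Proof.
move=> xy yc yd cx dx cd; rewrite leqNgt; apply/negP => /card_gt1P[a [b []]].
rewrite !inE -!orbA !negb_or => /andP[/and3P[ay ac ad] xa] /andP[/and3P[by_ bc bd] xb] ab.
have nloop u w : e u w -> u != w by move=> uw; apply/eqP => E; rewrite E e_irr in uw.
apply: (@noS22 x y a b c d) => //.
rewrite /= !inE !negb_or (nloop _ _ xy) (nloop _ _ xa) (nloop _ _ xb).
rewrite (nloop _ _ yc) (nloop _ _ yd) ab ac ad bc bd cd.
by rewrite ![x == _]eq_sym cx dx ![y == _]eq_sym ay by_.
Qed.

(** With [c], [d] two further neighbours of [y], at most one neighbour of [x] lies outside the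
    triple [y], [c], [d]. *)
Lemma deg_le4 x y : e x y -> 2 < deg y -> deg x <= 4.
Proof.
move=> xy dy; have : 1 < #|nbrs y :\ x|.
  by have := cardsD1 x (nbrs y); have := leq_b1 (x \in nbrs y); lia.
move=> /card_gt1P[c [d []]]; rewrite !inE => /andP[cx yc] /andP[dx yd] cd.
have := card_nbrs_outside xy yc yd cx dx cd.
have := cardsID [set y; c; d] (nbrs x).
have := subset_leq_card (subsetIr (nbrs x) [set y; c; d]).
have : #|[set y; c; d]| <= 3 by rewrite setUC cardsU1 cards2; lia.
lia.
Qed.

(** If a neighbour [c] of [y] were outside the closed neighbourhood of [x], then [x] would have at
    most the neighbours [y], [d] and one more, hence degree at most 3. *)
Lemma deg4_nbrs x y : e x y -> deg x = 4 -> 2 < deg y -> nbrs y \subset x |: nbrs x.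
Proof.
move=> xy dx4 dy; apply/subsetP => c; rewrite !inE => yc.
have [//|cx /=] := eqVneq c x; apply/negPn/negP => xc.
have : 0 < #|nbrs y :\ x :\ c|.
  have := cardsD1 x (nbrs y); have := cardsD1 c (nbrs y :\ x).
  by have := leq_b1 (x \in nbrs y); have := leq_b1 (c \in nbrs y :\ x); lia.
move=> /card_gt0P[d]; rewrite !inE => /and3P[dc dx yd].
have cd : c != d by rewrite eq_sym.
have := card_nbrs_outside xy yc yd cx dx cd.
have := cardsID [set y; c; d] (nbrs x).
have : #|nbrs x :&: [set y; c; d]| <= #|[set y; d]|.
  apply/subset_leq_card/subsetP => z; rewrite !inE => /andP[xz].
  by case/orP=> [/orP[->|/eqP zc]|->]; rewrite ?orbT //; rewrite zc (negbTE xc) in xz.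
by rewrite cards2; lia.
Qed.

Hypothesis noK5 : forall x, deg x = 4 ->
  exists u v, [/\ e x u, e x v, u != v & ~~ e u v].

Definition low v := deg v <= 2.
Definition isolated_high v := ~~ low v && [forall u in nbrs v, low u].
Definition linked_high v := ~~ low v && ~~ [forall u in nbrs v, low u].
(** The vertices of degree 4 that no low neighbour can supply with charge; their neighbours of
    degree 3 do so instead. *)
Definition saturated v := (deg v == 4) && [forall u in nbrs v, ~~ low u].

Lemma linked_high_deg v : linked_high v -> deg v <= 4.
Proof.
case/andP=> _; rewrite negb_forall_in => /exists_inP[u]; rewrite inE /low -ltnNge.
exact: deg_le4.
Qed.

Lemma linked_highI v u : ~~ low v -> e v u -> ~~ low u -> linked_high v.
Proof.
move=> lv vu lu; rewrite /linked_high lv negb_forall_in.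
by apply/exists_inP; exists u; rewrite ?inE.
Qed.

(** By [noK5] two neighbours [u], [v] of [x] are nonadjacent. By [deg4_nbrs] the neighbours of each
    lie among the five vertices of the closed neighbourhood of [x], without [u] and [v]: at most
    three, and high means at least three. *)
Lemma saturated_deg3 x : saturated x -> 1 < count_nbrs x (fun u => deg u == 3).
Proof.
move=> /andP[/eqP dx /forall_inP hi]; have [u [v [xu xv uv nuv]]] := noK5 dx.
have hi' w : e x w -> 2 < deg w by move=> xw; rewrite ltnNge; apply: hi; rewrite inE.
have deg3 w z : e x w -> e x z -> w != z -> ~~ e w z -> deg w = 3.
  move=> xw xz wz nwz; have := hi' w xw.
  have /subset_leq_card : nbrs w \subset (x |: nbrs x) :\ w :\ z.
    apply/subsetP => y wy; have := subsetP (deg4_nbrs xw dx (hi' w xw)) y wy.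
    move: wy; rewrite !inE => wy ->; rewrite andbT; apply/andP; split.
      by apply/eqP => yz; rewrite yz (negbTE nwz) in wy.
    by apply/eqP => yw; rewrite yw e_irr in wy.
  have := cardsD1 x (x |: nbrs x); have := cardsU1 x (nbrs x).
  have := cardsD1 w (x |: nbrs x); have := cardsD1 z ((x |: nbrs x) :\ w).
  by rewrite !inE xw xz e_irr (eq_sym z) wz !orbT /=; lia.
have du : deg u = 3 by exact: (deg3 u v).
have dv : deg v = 3 by apply: (deg3 v u) => //; rewrite 1?eq_sym 1?e_sym.
by apply/card_gt1P; exists u, v; rewrite !inE xu xv uv du dv.
Qed.

Lemma sum_deg_two_isolated : 1 < #|[set v | isolated_high v]| ->
  \sum_v deg v + 8 <= 4 * #|T|.
Proof.
move=> S2.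
suff : \sum_v (deg v + 4 * isolated_high v) <= \sum_(v : T) 4.
  have -> : \sum_(v : T) 4 = 4 * #|T| by rewrite sum_nat_const mulnC.
  rewrite big_split /= -big_distrr /=.
  have -> : \sum_v isolated_high v = #|[set v | isolated_high v]|.
    by rewrite -sum1dep_card [RHS]big_mkcond; apply: eq_bigr => u _; case: isolated_high.
  lia.
apply: (@discharging _ _ (fun u v => e u v && (low u && ~~ low v))) => v.
rewrite sum_nbrs_out sum_nbrs_in; have [lv|hv] := boolP (low v).
  have := count_nbrs_le v (fun u => true && ~~ low u).
  by rewrite /isolated_high lv /=; move: lv; rewrite /low; lia.
rewrite (@count_nbrs0 v (fun u => false && ~~ low u)) //.
have [iso|niso] := boolP (isolated_high v).
  rewrite count_nbrs_all; first lia.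
  by move=> u vu; case/andP: iso => _ /forall_inP->; rewrite ?inE.
have /linked_high_deg : linked_high v by move: niso; rewrite /isolated_high /linked_high hv.
lia.
Qed.

(** The budget is 18 per vertex against 5 times the degree. Low vertices send 5 to an isolated high
    neighbour and 3 to a linked one; linked vertices of degree 3 send 1 to each saturated
    neighbour. *)
Lemma sum_deg_one_isolated : #|[set v | isolated_high v]| <= 1 ->
  5 * \sum_v deg v <= 18 * #|T|.
Proof.
move=> S1; have <- : \sum_(v : T) 18 = 18 * #|T| by rewrite sum_nat_const mulnC.
rewrite big_distrr /=.
apply: (@discharging _ _ (fun u v =>
  5 * (e u v && (low u && isolated_high v)) +
  3 * (e u v && (low u && linked_high v)) +
  (e u v && (linked_high u && (deg u == 3) && saturated v)))) => v.
have split3 (f g h : T -> nat) : \sum_u (5 * f u + 3 * g u + h u) =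
    5 * \sum_u f u + 3 * \sum_u g u + \sum_u h u.
  by rewrite 2!big_split -!big_distrr.
rewrite !split3 !sum_nbrs_out !sum_nbrs_in {split3}.
have [lv|hv] := boolP (low v).
  have nlk : linked_high v = false by rewrite /linked_high lv.
  rewrite nlk (@count_nbrs0 v (fun u => false && _ && _)) //=.
  set s := count_nbrs v (fun u => isolated_high u).
  set m := count_nbrs v (fun u => linked_high u).
  have s1 : s <= 1.
    apply: leq_trans S1; apply/subset_leq_card/subsetP => u.
    by rewrite !inE => /andP[].
  have sm : s + m <= deg v.
    rewrite /s /m /count_nbrs -cardsUI [X in _ + X]eq_card0 ?addn0.
      by apply/subset_leq_card/subsetP => u; rewrite !inE => /orP[]/andP[].
    move=> u; rewrite !inE /isolated_high /linked_high.
    by case: (low u); case: [forall w in nbrs u, low w]; rewrite ?andbF.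
  (* The extreme case is 10 + 5 + 3 = 18: only one neighbour can be isolated high. *)
  by move: lv; rewrite /low; lia.
rewrite (@count_nbrs0 v (fun u => false && isolated_high u)) //.
have [iso|niso] := boolP (isolated_high v).
  have nlk : linked_high v = false.
    by case/andP: iso => _ all_low; rewrite /linked_high all_low andbF.
  rewrite nlk (@count_nbrs0 v (fun u => false && _ && _)) //.
  rewrite (@count_nbrs_all v (fun u => low u && true)); first lia.
  by move=> u vu; case/andP: iso => _ /forall_inP->; rewrite ?inE.
have lk : linked_high v by move: niso; rewrite /isolated_high /linked_high hv.
have d4 := linked_high_deg lk; rewrite lk.
(* Degree 3 costs at most 15 + 3 = 18. Degree 4 costs 20, covered by 18 + 2 if saturated
   ([saturated_deg3]) and by 18 + 3 from a low neighbour otherwise. *)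
have [d3|d3] := boolP (deg v == 3).
  have := count_nbrs_le v (fun u => true && true && saturated u).
  by move/eqP: d3; lia.
rewrite (@count_nbrs0 v (fun u => true && false && _)) //.
have {d3 d4} d4 : deg v = 4 by move: hv d3; rewrite /low; lia.
have [sat|nsat] := boolP (saturated v).
  have := saturated_deg3 sat.
  suff : count_nbrs v (fun u => deg u == 3) <=
      count_nbrs v (fun u => linked_high u && (deg u == 3) && true) by lia.
  apply/subset_leq_card/subsetP => u; rewrite !inE andbT => /andP[vu du].
  have uv : e u v by rewrite e_sym.
  have hu : ~~ low u by rewrite /low (eqP du).
  by rewrite vu du (linked_highI hu uv hv).
have : 0 < count_nbrs v (fun u => low u && true).
  move: nsat; rewrite /saturated d4 /= negb_forall_in => /exists_inP[u vu lu].
  by apply/card_gt0P; exists u; rewrite inE vu andbT -[low u]negbK.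
lia.
Qed.

End Discharging.

(** * Planar graphs without S_{2,2} *)

Section Graphs.
Variables (T : finType) (E : {set {set T}}).
Hypothesis E_simple : simple_graph E.

Definition adjacent u v := [set u; v] \in E.

Lemma adjacent_sym : symmetric adjacent.
Proof. by move=> u v; rewrite /adjacent setUC. Qed.

Lemma adjacent_irr : irreflexive adjacent.
Proof.
by move=> u; apply/negP => /E_simple; rewrite setUid cards1.
Qed.

Lemma sum_deg : \sum_v #|nbrs adjacent v| = 2 * #|E|.
Proof.
have degE v : #|nbrs adjacent v| = \sum_(A in E) (v \in A).
  have -> : \sum_(A in E) (v \in A) = #|[set A in E | v \in A]|.
    rewrite -sum1dep_card [RHS]big_mkcond [LHS]big_mkcond.
    by apply: eq_bigr => A _; case: (A \in E); case: (v \in A).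
  have inj : {in nbrs adjacent v &, injective (fun u => [set v; u])}.
    move=> u w; rewrite !inE => vu vw /setP/(_ u); rewrite !inE eqxx orbT.
    case/esym/orP => /eqP // uv.
    by rewrite uv adjacent_irr in vu.
  rewrite -(card_in_imset inj); apply: eq_card => A; rewrite inE.
  apply/imsetP/andP => [[u vu ->]|[AE vA]].
    by rewrite !inE eqxx; rewrite inE in vu.
  have /cards2P[x [y [_ EA]]] : #|A| == 2 by rewrite (E_simple AE).
  move: vA AE; rewrite EA !inE => /orP[]/eqP-> xyE.
    by exists y; rewrite ?inE.
  by exists x; rewrite ?inE /adjacent setUC.
rewrite (eq_bigr _ (fun v _ => degE v)) exchange_big /= mulnC -sum_nat_const.
apply: eq_bigr => A AE; rewrite -(E_simple AE) -sum1_card [RHS]big_mkcond.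
by apply: eq_bigr => v _; case: (v \in A).
Qed.

Lemma double_star22_free x y a b c d :
  ~ contains_subgraph E (double_star 2 2) -> uniq [:: x; y; a; b; c; d] ->
  adjacent x y -> adjacent x a -> adjacent x b -> adjacent y c ->
  adjacent y d -> False.
Proof.
move=> free uq xy xa xb yc yd; apply: free.
(* The list follows the vertex numbering of [double_star]: backbone, leaves of [x], leaves of
   [y]. *)
exists (fun i : 'I_(2 + 2 + 2) => nth x [:: x; y; a; b; c; d] i); split.
  by move=> i j /eqP; rewrite nth_uniq ?ltn_ord // => /eqP/val_inj.
move=> A; rewrite inE => /existsP[i /existsP[j /andP[/eqP-> ij]]].
rewrite imsetU !imset_set1; move: ij; rewrite /dstar_adj.
by case: i j => [[|[|i]] // ?] [[|[|[|[|[|[|j]]]]]] // ?].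
Qed.

(** Otherwise the closed neighbourhood of [x], enumerated by ['I_5], would be a [K_5]. *)
Lemma planar_deg4 x : planar E -> #|nbrs adjacent x| = 4 ->
  exists u v, [/\ adjacent x u, adjacent x v, u != v & ~~ adjacent u v].
Proof.
move=> plE d4; pose N := x |: nbrs adjacent x.
have N5 : 5 = #|N| by rewrite cardsU1 inE adjacent_irr d4.
have [/existsP[u /existsP[v /and4P[? ? ? ?]]]|none] := boolP [exists u, exists v,
    [&& adjacent x u, adjacent x v, u != v & ~~ adjacent u v]]; first by exists u, v.
case: (planar_no_K5 plE (x := fun i => enum_val (cast_ord N5 i))).
  by move=> i j /enum_val_inj/cast_ord_inj.
move=> i j ij; have : enum_val (cast_ord N5 i) != enum_val (cast_ord N5 j).
  by rewrite (inj_eq enum_val_inj) (inj_eq (@cast_ord_inj _ _ _)).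
move: (enum_valP (cast_ord N5 i)) (enum_valP (cast_ord N5 j)).
move: (enum_val (cast_ord N5 i)) (enum_val (cast_ord N5 j)) => u v.
rewrite /N !inE => uN vN uv.
case/orP: uN uv => [/eqP->|xu].
  by case/orP: vN => [/eqP->|//]; rewrite eqxx.
case/orP: vN => [/eqP-> _|xv uv]; first by rewrite setUC.
apply: contraNT none => nuv; apply/existsP; exists u; apply/existsP; exists v.
by rewrite xu xv uv nuv.
Qed.

Lemma planar_double_star22_free_bound : 16 <= #|T| -> planar E ->
  ~ contains_subgraph E (double_star 2 2) -> #|E| <= 2 * #|T| - 4.
Proof.
move=> n16 plE free.
have noS22 x y a b c d := @double_star22_free x y a b c d free.
have noK5 x := planar_deg4 (x := x) plE.
have := sum_deg_two_isolated adjacent_sym adjacent_irr noS22.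
have := sum_deg_one_isolated adjacent_sym adjacent_irr noS22 noK5.
(* With at most one isolated high vertex, [#|E|] is at most the floor of 9n/5 for n = [#|T|], that
   is 2n minus the ceiling of n/5; this ceiling is at least 4 exactly from n = 16 on. *)
by rewrite sum_deg; lia.
Qed.

End Graphs.

(** * Line segments as simple arcs *)

Section Segments.
Local Open Scope R_scope.

Definition segment (p q : R * R) (t : R) : R * R :=
  ((1 - t) * p.1 + t * q.1, (1 - t) * p.2 + t * q.2).

Lemma segment_simple_arc p q : p <> q -> simple_arc (segment p q) p q.
Proof.
case: p q => [a b] [c d] pq; split; last first.
  rewrite /segment /=; split; last by split; congr pair; lra.
  move=> s t _ _ [E1 E2]; apply: Rminus_diag_uniq.
  have F1 : (s - t) * (c - a) = 0 by lra.
  have F2 : (s - t) * (d - b) = 0 by lra.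
  have [//|F1'] := Rmult_integral _ _ F1; have [//|F2'] := Rmult_integral _ _ F2.
  by case: pq; congr pair; lra.
(* [K] is a Lipschitz constant for both coordinates; the summand 1 makes it positive. *)
move=> t _ eps eps0; pose K := 1 + Rabs (c - a) + Rabs (d - b).
have [ca db] := (Rabs_pos (c - a), Rabs_pos (d - b)).
have K0 : 0 < K by rewrite /K; lra.
exists (eps / K); split; first exact: Rdiv_lt_0_compat.
move=> s _ st; rewrite /segment /=.
have bound z : Rabs z <= K -> Rabs ((s - t) * z) < eps.
  move=> zK; rewrite Rabs_mult; apply: (Rle_lt_trans _ (Rabs (s - t) * K)).
    exact/Rmult_le_compat_l/zK/Rabs_pos.
  by rewrite (_ : eps = eps / K * K); [exact: Rmult_lt_compat_r | field; lra].
split.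
  rewrite (_ : _ - _ = (s - t) * (c - a)); last by ring.
  by apply: bound; rewrite /K; lra.
rewrite (_ : _ - _ = (s - t) * (d - b)); last by ring.
by apply: bound; rewrite /K; lra.
Qed.

End Segments.

(** * The complete bipartite graph K_{2,n-2} *)

Section K2n.
Variable n : nat.
Hypothesis n2 : 2 <= n.

Definition K2n : {set {set 'I_n}} :=
  [set [set ij.1; ij.2] | ij in setX [set i : 'I_n | i < 2] [set j : 'I_n | ~~ (j < 2)]].

Lemma K2nP (u v : 'I_n) : [set u; v] \in K2n ->
  exists a b : 'I_n, [/\ a < 2, 2 <= b, [set u; v] = [set a; b] &
    (u = a /\ v = b) \/ (u = b /\ v = a)].
Proof.
case/imsetP => -[a b]; rewrite !inE /= => /andP[a2 b2] E.
exists a, b; split=> //; first by rewrite leqNgt.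
have neq : a != b by apply/eqP => ab; rewrite -ab a2 in b2.
have /setP/(_ u) := E; have /setP/(_ v) := E; rewrite !inE !eqxx orbT /=.
case/esym/orP=> /eqP vE /esym/orP[]/eqP uE; auto.
- have /setP/(_ b) := E; rewrite !inE uE vE eqxx orbT orbb => ba.
  by rewrite eq_sym ba in neq.
- have /setP/(_ a) := E; rewrite !inE uE vE eqxx orbb => ab.
  by rewrite ab in neq.
Qed.

Lemma card_K2n : #|K2n| = 2 * (n - 2).
Proof.
have A2 : #|[set i : 'I_n | i < 2]| = 2.
  have E : [set i : 'I_n | i < 2] = [set widen_ord n2 i | i in 'I_2].
    apply/setP => i; rewrite inE; apply/idP/imsetP => [i2|[j _ ->]].
      by exists (Ordinal i2) => //; apply: val_inj.
    exact: (ltn_ord j).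
  by rewrite E card_imset ?card_ord // => i j [] /val_inj.
rewrite card_in_imset.
  rewrite cardsX A2; congr (_ * _).
  have := cardsC [set i : 'I_n | i < 2]; rewrite A2 card_ord.
  have -> : ~: [set i : 'I_n | i < 2] = [set j : 'I_n | ~~ (j < 2)].
    by apply/setP => j; rewrite !inE.
  lia.
move=> [a b] [c d]; rewrite !inE /= => /andP[a2 b2] /andP[c2 d2] E.
have /setP/(_ a) := E; have /setP/(_ b) := E; rewrite !inE !eqxx orbT /=.
case/esym/orP=> /eqP bE; first by rewrite bE c2 in b2.
case/esym/orP=> /eqP aE; first by rewrite bE aE.
by rewrite -aE a2 in d2.
Qed.

Lemma K2n_simple : simple_graph K2n.
Proof.
move=> A /imsetP[[a b]]; rewrite !inE /= => /andP[a2 b2] ->.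
rewrite cards2; suff -> : a != b by [].
by apply/eqP => ab; rewrite ab (negbTE b2) in a2.
Qed.

(** Edges join the two sides, so one end of the backbone lies outside the part of size 2, and its
    three neighbours would all lie in that part. *)
Lemma K2n_double_star22_free : ~ contains_subgraph K2n (double_star 2 2).
Proof.
move=> [f [f_inj fE]].
pose o k : 'I_(2 + 2 + 2) := inord k.
have oE i j : dstar_adj (m := 2) (k := 2) i j -> [set f i; f j] \in K2n.
  move=> ij; rewrite -!imset_set1 -imsetU; apply: fE; rewrite inE.
  by apply/existsP; exists i; apply/existsP; exists j; rewrite eqxx.
have adj2 u v : [set u; v] \in K2n -> (u < 2) != (v < 2).
  move=> /K2nP[a [b [a2 b2 _ []]]] [-> ->]; rewrite a2 ltnNge b2 //.
have ne i j : (i < 6) -> (j < 6) -> i != j -> f (o i) != f (o j).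
  move=> i6 j6 ij; rewrite (inj_eq f_inj); apply: contraNneq ij => /(congr1 val).
  by rewrite /= !inordK // => ->.
have lt2 i j k : i < 6 -> j < 6 -> k < 6 -> uniq [:: i; j; k] ->
    ~~ [&& f (o i) < 2, f (o j) < 2 & f (o k) < 2].
  move=> i6 j6 k6; rewrite /= !inE negb_or andbT => /andP[/andP[ij ik] jk].
  have := ne i j i6 j6 ij; have := ne i k i6 k6 ik; have := ne j k j6 k6 jk.
  rewrite -!val_eqE /=; lia.
have dE i j : i < 6 -> j < 6 -> [|| (i == 0) && (j == 1), (i == 0) && (2 <= j) && (j < 4)
    | (i == 1) && (4 <= j)] -> (f (o i) < 2) != (f (o j) < 2).
  by move=> i6 j6 ij; apply/adj2/oE; rewrite /dstar_adj !inordK.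
have := dE 0 1 isT isT isT; have := dE 0 2 isT isT isT; have := dE 0 3 isT isT isT.
have := dE 1 4 isT isT isT; have := dE 1 5 isT isT isT.
have := lt2 1 2 3 isT isT isT isT; have := lt2 0 4 5 isT isT isT isT.
by do 6!case: (_ < 2).
Qed.

Local Open Scope R_scope.

(** For a straight-line drawing: edges at different poles stay on opposite sides of the horizontal
    axis, and edges at the same pole have different slopes. *)
Definition K2n_pos (i : 'I_n) : R * R :=
  match nat_of_ord i with 0%N => (0, 1) | 1%N => (0, -1) | k => (INR k, 0) end.

Lemma K2n_posP (i : 'I_n) :
  [\/ nat_of_ord i = 0%N /\ K2n_pos i = (0, 1), nat_of_ord i = 1%N /\ K2n_pos i = (0, -1)
    | (2 <= nat_of_ord i)%N /\ K2n_pos i = (INR (nat_of_ord i), 0) /\ 0 < INR (nat_of_ord i)].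
Proof.
rewrite /K2n_pos; case: (nat_of_ord i) => [|[|k]]; [by constructor 1|by constructor 2|].
constructor 3; split=> //; split=> //; exact: lt_0_INR (Nat.lt_0_succ _).
Qed.

Lemma K2n_pos_inj : injective K2n_pos.
Proof.
move=> i j ij; apply: ord_inj.
have [e1 e2] : (K2n_pos i).1 = (K2n_pos j).1 /\ (K2n_pos i).2 = (K2n_pos j).2.
  by rewrite ij.
case: (K2n_posP i) e1 e2 => [[-> ->]|[-> ->]|[_ [-> ?]]];
  case: (K2n_posP j) => [[-> ->]|[-> ->]|[_ [-> ?]]] /= e1 e2;
  first [reflexivity | exfalso; lra | exact: INR_eq].
Qed.

(* On the open edge from a pole [(0, y)] to [(INR b, 0)] the sign of the second
   coordinate recovers [y], and then the slope recovers [b]. *)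
Lemma K2n_segment u v t : [set u; v] \in K2n -> in01o t ->
  exists (a b : 'I_n) (y s : R), [/\ [set u; v] = [set a; b], in01o s,
    y = 1 /\ nat_of_ord a = 0%N \/ y = -1 /\ nat_of_ord a = 1%N, 0 < INR (nat_of_ord b) &
    segment (K2n_pos u) (K2n_pos v) t = (s * INR (nat_of_ord b), (1 - s) * y)].
Proof.
move=> /K2nP[a [b [a2 b2 E uv]]] [t0 t1].
have [y [aE yE]] : exists y, K2n_pos a = (0, y) /\
    (y = 1 /\ nat_of_ord a = 0%N \/ y = -1 /\ nat_of_ord a = 1%N).
  case: (K2n_posP a) => [[? ->]|[? ->]|[? _]]; [by exists 1; auto|by exists (-1); auto|].
  by lia.
have [bE b0] : K2n_pos b = (INR (nat_of_ord b), 0) /\ 0 < INR (nat_of_ord b).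
  by case: (K2n_posP b) => [[]|[]|[_ ?]] //; lia.
case: uv => -[-> ->]; rewrite aE bE.
  exists a, b, y, t; split=> //; rewrite /segment /=; congr pair; ring.
exists a, b, y, (1 - t); split=> //; first by rewrite setUC.
  by rewrite /in01o; lra.
by rewrite /segment /=; congr pair; ring.
Qed.

Lemma K2n_planar : planar K2n.
Proof.
exists K2n_pos, (fun u v => segment (K2n_pos u) (K2n_pos v)).
split; first exact: K2n_pos_inj.
split=> [u v uv|].
  apply: segment_simple_arc => /K2n_pos_inj uE.
  by have := K2n_simple uv; rewrite uE setUid cards1.
split=> [u v w t uv t01|u v u' v' t t' uv uv' neq t01 t01'].
  (* Both coordinates are nonzero on an open edge, whereas every vertex lies on an axis. *)
  have [a [b [y [s [_ [s0 s1] yE b0 ->]]]]] := K2n_segment uv t01.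
  have ? := Rmult_lt_0_compat _ _ s0 b0.
  case: (K2n_posP w) => [[_ ->]|[_ ->]|[_ [-> _]]] []; try lra.
  by move=> _; case: yE => -[-> _]; lra.
have [a [b [y [s [E [s0 s1] yE b0 ->]]]]] := K2n_segment uv t01.
have [a' [b' [y' [s' [E' [s0' s1'] yE' b0' ->]]]]] := K2n_segment uv' t01'.
move=> [e1 e2]; case/negP: neq; rewrite E E'.
have [ss aa] : s = s' /\ a = a'.
  by case: yE yE' e2 => -[-> aE] [] [-> aE'] e2; split; try apply: ord_inj; try lra;
     rewrite ?aE ?aE'.
have bb : b = b'.
  apply/ord_inj/INR_eq; apply: (Rmult_eq_reg_l s); last lra.
  by rewrite e1 ss.
by rewrite aa bb.
Qed.

End K2n.

Theorem theorem1p1 (n : nat) (hn : 16 <= n) :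
  is_planar_turan_number n (double_star 2 2) (2 * n - 4).
Proof.
have n2 : 2 <= n by apply: leq_trans hn.
split.
  exists (K2n n); split; first exact: K2n_simple.
  split; first exact: K2n_planar.
  split; first exact: K2n_double_star22_free.
  by rewrite card_K2n // mulnBr.
move=> E simE plE free; have := planar_double_star22_free_bound simE _ plE free.
by rewrite card_ord; apply.
Qed.
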